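(* Let $\mu>0$, $t_0>0$, and let $S:[0,+\infty)\to[0,1)$ be continuously differentiable, increasing, and concave, with $S(0)=0$. Suppose that $$0<2S'(r)+S(r)^2\le1\qquad\text{for all }r\ge0,$$ that $S'(0)=\kappa$ with $\kappa\in(0,\frac12]$, that $S(r)\to1$ and $S'(r)\to0$ as $r\to+\infty$, and that $$\xi:=\int_0^{+\infty}\bigl(1-S(r)\bigr)\,dr<+\infty .$$ For the coefficient choice $$\theta(t)=\frac1{\sqrt\mu}S(\sqrt\mu\,t),$$ the corresponding damping coefficient $\delta_\mu(t)=\frac{1+\dot\theta(t)}{\theta(t)}+\mu\theta(t)$ satisfies, for every fixed $t>0$, $$\delta_\mu(t)\to\frac{\gamma}{t}\quad\text{as }\mu\downarrow0,\qquad\gamma:=1+\frac1\kappa\ge3,$$ and, for every fixed $\mu>0$, $\delta_\mu(t)\to2\sqrt\mu$ as $t\to+\infty$. Moreover, let $\mathcal H$ be a real Hilbert space and let $\Phi:\mathcal H\to\mathbb R$ be continuously Fréchet differentiable and $\mu$-strongly convex with $\operatorname{argmin}\Phi\ne\varnothing$, $x^*\in\operatorname{argmin}\Phi$, $\Phi^*=\Phi(x^* )$. Then every global solution $x\in C^2([t_0,+\infty),\mathcal H)$ of $$\ddot x(t)+\delta_\mu(t)\dot x(t)+\nabla\Phi(x(t))=0,\qquad t\ge t_0,$$ satisfies, for every $t\ge t_0$, $$\Phi(x(t))-\Phi^*\le\mathcal E(t_0)\min\left\{\frac1{C_{\mu,t_0}t^2},\ \frac{\mu\,e^{\sqrt\mu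 t_0+\xi}}{S(\sqrt\mu t_0)^2}\,e^{-\sqrt\mu t}\right\},$$ where $$C_{\mu,t_0}:=\begin{cases}\min\left\{S(1)^2,\ \dfrac{S(1)^4}{4}e^{2-S(1)}\right\},&\sqrt\mu\,t_0\le1,\\[2ex]\dfrac{S(\sqrt\mu t_0)^4}{4}\,e^{2-S(\sqrt\mu t_0)\sqrt\mu t_0},&\sqrt\mu\,t_0>1.\end{cases}$$ In particular, $\Phi(x(t))-\Phi^*=\mathcal O\left(\min\left\{\frac1{t^2},e^{-\sqrt\mu t}\right\}\right)$.
   Context: A differentiable function $\Phi$ on $\mathcal H$ is $\mu$-strongly convex if $\Phi(y)\ge\Phi(x)+\langle\nabla\Phi(x),y-x\rangle+\frac{\mu}{2}\|y-x\|^2$ for all $x,y\in\mathcal H$. The quantity $\mathcal E(t_0)$ is the value at $t=t_0$ of $$\mathcal E(t)=A(t)\bigl(\Phi(x(t))-\Phi^*\bigr)+\frac{A(t)}{2\theta(t)^2}\left\|x(t)-x^*+\theta(t)\dot x(t)\right\|^2,\qquad A(t)=\theta(t)^2\exp\left(\int_{t_0}^t\mu\theta(s)\,ds\right),$$ so $A(t_0)=\theta(t_0)^2$. In the limit $\mu\downarrow0$ the function $S$ is fixed (independent of $\mu$). *)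

(* Defs.v *)
From HB Require Import structures.
From mathcomp Require Import all_boot all_order all_algebra sesquilinear.
From mathcomp Require Import all_classical all_reals all_analysis.

Set Implicit Arguments.
Unset Strict Implicit.
Unset Printing Implicit Defensive.

Import Order.TTheory GRing.Theory Num.Theory.
Import numFieldNormedType.Exports.

Local Open Scope classical_set_scope.
Local Open Scope ring_scope.

(* Lets the Landau notations be used at +oo, as the library does for \oo. *)
Canonical pinfty_filterType (R : realType) :=
  FilterType (pinfty_nbhs R) _.

Section derive_within.
Context {R : realType} {V : normedModType R}.
Implicit Types (D : set R) (f : R -> V).

(* Difference quotients are restricted to D, so that on D = [a, +oo[ the
   derivative at a is the right derivative and the values of f outside D are
   irrelevant. *)
Definition derivable_within D f (t : R) : Prop :=
  cvg ((s - t)^-1 *: (f s - f t) @[s --> within D t^']).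

Definition derive_within D f (t : R) : V :=
  lim ((s - t)^-1 *: (f s - f t) @[s --> within D t^']).

Definition C1_within D f : Prop :=
  (forall t, D t -> derivable_within D f t) /\
  {within D, continuous (derive_within D f)}.

Definition C2_within D f : Prop :=
  C1_within D f /\ C1_within D (derive_within D f).

End derive_within.

Section hilbert.
Context {R : realType} {H : completeNormedModType R}.
Implicit Types (ip : {dot H for idfun}) (Phi : H -> R).

(* With the completeness of H, this makes (H, ip) a real Hilbert space whose
   topology is the one of H. *)
Definition induces_norm ip : Prop := forall u, ip u u = `|u| ^+ 2.

(* Continuity of u |-> 'd Phi u is for the operator norm on the dual of H. *)
Definition C1_frechet Phi : Prop :=
  (forall u, differentiable Phi u) /\
  (forall u (e : R), 0 < e ->
    \forall v \near u, forall w, `|'d Phi v w - 'd Phi u w| <= e * `|w|).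

(* The Riesz representative of the differential. *)
Definition gradient ip Phi (u : H) : H :=
  get [set g : H | forall v, 'd Phi u v = ip g v].

Definition strongly_convex ip (mu : R) Phi : Prop :=
  forall u v,
    Phi v >= Phi u + ip (gradient ip Phi u) (v - u) + mu / 2 * `|v - u| ^+ 2.

Definition argmin Phi : set H := [set u | forall v, Phi u <= Phi v].

End hilbert.

Section coefficients.
Context {R : realType}.
Implicit Types (S : R -> R) (mu t : R).

Definition theta S mu t : R := (Num.sqrt mu)^-1 * S (Num.sqrt mu * t).

(* The two-sided derivative is the intended one only for t > 0; the values of S
   on the negative reals then play no role. *)
Definition damping S mu t : R :=
  (1 + derive1 (theta S mu) t) / theta S mu t + mu * theta S mu t.

Definition xi S : R := \int[lebesgue_measure]_(r in `[0, +oo[) (1 - S r).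

Definition rate_constant S mu (t0 : R) : R :=
  let r0 := Num.sqrt mu * t0 in
  if r0 <= 1 then Num.min (S 1 ^+ 2) (S 1 ^+ 4 / 4 * expR (2 - S 1))
  else S r0 ^+ 4 / 4 * expR (2 - S r0 * r0).

Definition weight S mu (t0 : R) t : R :=
  theta S mu t ^+ 2 *
  expR (\int[lebesgue_measure]_(s in `[t0, t]) (mu * theta S mu s)).

Definition energy (H : completeNormedModType R) S mu (t0 : R)
    (Phi : H -> R) (xs : H) (x : R -> H) t : R :=
  weight S mu t0 t * (Phi (x t) - Phi xs) +
  weight S mu t0 t / (2 * theta S mu t ^+ 2) *
  `|x t - xs + theta S mu t *: derive_within `[t0, +oo[ x t| ^+ 2.

Definition solution (H : completeNormedModType R) (ip : {dot H for idfun})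
    S mu (t0 : R) (Phi : H -> R) (x : R -> H) : Prop :=
  let D := `[t0, +oo[%classic in
  C2_within D x /\
  forall t, t0 <= t ->
    derive_within D (derive_within D x) t + damping S mu t *: derive_within D x t
      + gradient ip Phi (x t) = 0.

End coefficients.

(* Main.v *)
Require Import Defs.
From mathcomp Require Import all_boot all_order all_algebra sesquilinear.
From mathcomp Require Import all_classical all_reals all_analysis.
From mathcomp Require Import measurable_realfun ring lra.
Import Order.TTheory GRing.Theory Num.Theory.
Import numFieldNormedType.Exports.

Set Implicit Arguments.
Unset Strict Implicit.

Local Open Scope classical_set_scope.
Local Open Scope ring_scope.

(** Write q for the square root of mu, r = q t, r0 = q t0, theta = S(r) / q.

    Both limits of the damping coefficient are read off from its expression in
    the variable r: it is ((1 + S'(r)) / (S(r)/r)) / t + (r/t) S(r), where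
    S(r)/r and S'(r) tend to kappa as r tends to 0, and it is also
    q ((1 + S'(r)) / S(r) + S(r)), where S(r) tends to 1 and S'(r) to 0 as r
    tends to +oo ([cvg_damping_mu0], [cvg_damping_pinfty]).

    The convergence rates come from the energy E.  Put d = x - x*, so that
    E = W (theta^2 (Phi(x) - Phi* ) + |d + theta x'|^2 / 2), where W is the
    exponential of the integral of mu theta from t0 to t.  The damping is
    exactly such that theta delta = 1 + theta' + mu theta^2; with it, the
    cross terms <d, x'> and <grad Phi(x), x'> cancel in the derivative and
      E' / W = - theta (1 - 2 theta' - mu theta^2) (Phi(x) - Phi* )
               - theta (<grad Phi(x), d> - (Phi(x) - Phi* ) - mu |d|^2 / 2)
               - mu theta^3 |x'|^2 / 2.
    All three terms are nonpositive: the first because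
    2 theta' + mu theta^2 = 2 S'(r) + S(r)^2 <= 1, the second by strong
    convexity ([dissipation_le0]).  Hence E is nonincreasing
    ([energy_nincr]) and Phi(x) - Phi* <= E(t0) / A(t), where
    A = theta^2 W is the weight of the energy ([objective_gap_le]).

    It remains to bound A(t) = (S(r)^2 / mu) exp G(t) from below, where
    G' = q S(q t) and G(t0) = 0.  On the one hand S(r) = 1 - (1 - S(r)) gives
    G(t) >= r - r0 - xi, which is the exponential rate ([weight_ge_expR]).  On
    the other hand S is at least s = S(b) after r = b, so
    A(t) >= (s^2 / mu) exp (s (r - b)), and exp (y - 1) >= y with y = s r / 2
    turns this into the rate t^2; when r <= 1 concavity alone, in the form
    S(r) >= r S(1), is enough ([weight_ge_sqr]). *)

(** * One-sided and two-sided derivatives on the line *)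

Lemma is_derive_quotient {R : realType} {V : normedModType R} (f : R -> V)
    (t : R) (l : V) :
  h^-1 *: (f (h + t) - f t) @[h --> 0^'] --> l -> is_derive t 1 f l.
Proof.
move=> fl.
have der : h^-1 *: ((f \o shift t) (h *: (1 : R)) - f t) @[h --> 0^'] --> l.
  apply: cvg_trans fl; apply: near_eq_cvg; apply: nearW => h /=.
  by rewrite [h *: 1]mulr1.
by split; [apply/cvg_ex; exists l|exact: cvg_lim].
Qed.

Lemma is_derive_cvg_quotient {R : realType} {V : normedModType R} (f : R -> V)
    (t : R) (l : V) :
  is_derive t 1 f l -> h^-1 *: (f (h + t) - f t) @[h --> 0^'] --> l.
Proof.
move=> [fd <-]; apply: cvg_trans fd; apply: near_eq_cvg; apply: nearW => h /=.
by rewrite [h *: 1]mulr1.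
Qed.

Lemma is_derive_slope {R : realType} {V : normedModType R} (f : R -> V)
    (t : R) (l : V) :
  (s - t)^-1 *: (f s - f t) @[s --> t^'] --> l -> is_derive t 1 f l.
Proof.
have shift_t : (h + t)%R @[h --> 0^'] --> t^'.
  move=> A; rewrite /nbhs/= /dnbhs /within/= => /nbhs_ballP[e /= e0 eA].
  suff: \forall h \near (0 : R), h != 0 -> A (h + t) by [].
  near=> h => h0; apply: eA; last by rewrite -subr_eq0 addrK.
  rewrite /ball/= opprD addrCA subrr addr0 normrN.
  by near: h; exact: (@nbhs0_lt R R).
move=> /(cvg_comp _ _ shift_t) fl; apply: is_derive_quotient.
apply: cvg_trans fl; apply: near_eq_cvg; apply: nearW => h /=.
by rewrite addrK.
Unshelve. all: by end_near. Qed.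

Lemma within_dnbhs {R : realType} (D : set R) (t : R) :
  nbhs t D -> within D t^' = t^'.
Proof.
move=> Dt; rewrite eqEsubset; split => A /=; rewrite /within/= /dnbhs /within/=.
  by apply: filterS2 Dt => s + + st => /[swap] /(_ st) /[apply].
by apply: filterS => s + st _; exact.
Qed.

Lemma derivable_within_is_derive {R : realType} {V : normedModType R}
    (D : set R) (f : R -> V) (t : R) :
  nbhs t D -> derivable_within D f t ->
  is_derive t 1 f (derive_within D f t).
Proof.
move=> Dt; rewrite /derivable_within /derive_within.
by rewrite within_dnbhs// => /is_derive_slope.
Qed.

(** The quotients converge only along the punctured filter; the point [t]
    itself is harmless since [f t] is in each of its own neighbourhoods. *)
Lemma derivable_within_cvg {R : realType} {V : normedModType R}
    (D : set R) (f : R -> V) (t : R) :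
  derivable_within D f t -> f s @[s --> within D (nbhs t)] --> f t.
Proof.
move=> df.
have fD : f s @[s --> within D t^'] --> f t.
  have : f t + (s - t) *: ((s - t)^-1 *: (f s - f t)) @[s --> within D t^'] -->
         f t + (t - t) *: derive_within D f t.
    apply: cvgD; first exact: cvg_cst.
    apply: cvgZ => //; apply: cvgB; last exact: cvg_cst.
    by apply: cvg_within_filter; apply: cvg_within.
  rewrite subrr scale0r addr0; apply: cvg_trans; apply: near_eq_cvg.
  rewrite near_withinE; near=> s => _.
  rewrite scalerA divff ?scale1r ?subrKC// subr_eq0.
  by near: s; exact: nbhs_dnbhs_neq.
move=> A fA; have fDA : \forall s \near t, s != t -> D s -> A (f s) := fD A fA.
suff: \forall s \near t, D s -> A (f s) by [].
near=> s => Ds; have [->|st] := eqVneq s t; first exact: nbhs_singleton.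
have sA : s != t -> D s -> A (f s) by near: s; exact: fDA.
exact: sA.
Unshelve. all: by end_near. Qed.

Lemma derivable_within_subspace_continuous {R : realType} {V : normedModType R}
    (D : set R) (f : R -> V) :
  (forall t, D t -> derivable_within D f t) -> {within D, continuous f}.
Proof.
by move=> df; apply/subspace_continuousP => t /df /derivable_within_cvg.
Qed.

Lemma is_derive_continuous {R : realType} {V : normedModType R} (f : R -> V)
  (t : R) (l : V) : is_derive t 1 f l -> {for t, continuous f}.
Proof. by move=> [/derivable1_diffP /differentiable_continuous]. Qed.

(** A mean value argument on the half-line: at the end point [a], where [F]
    need not have a derivative, continuity from the right is enough. *)
Lemma is_derive_ge0_ndecr {R : realType} (F dF : R -> R) (a : R) :
  F s @[s --> within `[a, +oo[ (nbhs a)] --> F a ->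
  (forall t, a < t -> is_derive t 1 F (dF t)) ->
  (forall t, a < t -> 0 <= dF t) ->
  forall t, a <= t -> F a <= F t.
Proof.
move=> Fa derF dF0 t at_.
apply: (@ger0_derive1_ndecry _ F a) => //.
- by move=> x; rewrite in_itv/= andbT => /derF [].
- move=> x; rewrite in_itv/= andbT => ax; rewrite derive1E.
  by case: (derF _ ax) => _ ->; exact: dF0.
apply/subspace_continuousP => x /=; rewrite in_itv/= andbT le_eqVlt.
move=> /predU1P[<-//|/derF /is_derive_continuous]; exact: cvg_within_filter.
Qed.

(** * Inner products and gradients *)

Section inner_product.
Context {R : realType} {H : completeNormedModType R} (ip : {dot H for idfun}).
Hypothesis ipE : induces_norm ip.

Lemma ipC u v : ip u v = ip v u.
Proof. by rewrite hermC/= expr0 mul1r. Qed.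

Lemma ipDl u v w : ip (u + v) w = ip u w + ip v w.
Proof. by rewrite linearDl. Qed.

Lemma ipDr u v w : ip u (v + w) = ip u v + ip u w.
Proof. by rewrite linearDr. Qed.

Lemma ipZl a u w : ip (a *: u) w = a * ip u w.
Proof. by rewrite linearZl_LR. Qed.

Lemma ipZr a u w : ip u (a *: w) = a * ip u w.
Proof. by rewrite linearZr_LR. Qed.

Lemma ipNl u w : ip (- u) w = - ip u w.
Proof. by rewrite linearNl. Qed.

Lemma ipNr u w : ip u (- w) = - ip u w.
Proof. by rewrite linearNr. Qed.

Lemma ip_CauchySchwarz u v : `|ip u v| <= `|u| * `|v|.
Proof.
have [->|v0] := eqVneq v 0.
  by rewrite -(scale0r 0) ipZr mul0r normr0 normrZ normr0 mul0r mulr0.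
have v2 : 0 < ip v v by rewrite ipE exprn_gt0// normr_gt0.
have : 0 <= ip (ip v v *: u - ip u v *: v) (ip v v *: u - ip u v *: v).
  by rewrite ipE exprn_ge0.
rewrite !(ipDl, ipDr, ipNl, ipNr, ipZl, ipZr) (ipC v u) => h.
have {}h : 0 <= ip v v * (ip v v * ip u u - ip u v ^+ 2) by lra.
move: h; rewrite pmulr_rge0// subr_ge0 !ipE -exprMn mulrC => h.
by rewrite -ler_sqr ?nnegrE ?mulr_ge0// real_normK ?num_real.
Qed.

Lemma cvg_ip {T : Type} (F : set_system T) {FF : Filter F} (f g : T -> H) a b :
  f @ F --> a -> g @ F --> b -> ip (f s) (g s) @[s --> F] --> ip a b.
Proof.
move=> fa gb.
have z : `|f s - a| * `|g s| + `|a| * `|g s - b| @[s --> F] --> (0 : R).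
  rewrite -[X in _ --> X](_ : `|a - a| * `|b| + `|a| * `|b - b| = 0);
    last by rewrite !subrr !normr0 mul0r mulr0 addr0.
  by apply: cvgD; apply: cvgM; (try exact: cvg_cst); apply: cvg_norm => //;
    apply: cvgB => //; exact: cvg_cst.
apply/cvgrPdist_le => e e0; move/cvgrPdist_le : z => /(_ e e0).
apply: filterS => s; rewrite sub0r normrN; apply: le_trans.
rewrite distrC; apply: le_trans (ler_norm _).
rewrite (_ : ip (f s) (g s) - ip a b = ip (f s - a) (g s) + ip a (g s - b)).
  by apply: (le_trans (ler_normD _ _)); apply: lerD; exact: ip_CauchySchwarz.
by rewrite !(ipDl, ipDr, ipNl, ipNr); lra.
Qed.

(** The product rule, read off from the difference quotient
    <(f (t + h) - f t) / h, g (t + h)> + <f t, (g (t + h) - g t) / h> and the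
    joint continuity of the inner product. *)
Lemma is_derive_ip (f g : R -> H) (t : R) (df dg : H) :
  is_derive t 1 f df -> is_derive t 1 g dg ->
  is_derive t 1 (fun s => ip (f s) (g s)) (ip df (g t) + ip (f t) dg).
Proof.
move=> f' g'; apply: is_derive_quotient.
have gt : g (h + t) @[h --> 0^'] --> g t.
  have := is_derive_continuous g'.
  move/(continuous_withinNshiftx g t).2; exact.
have fl : ip (h^-1 *: (f (h + t) - f t)) (g (h + t)) +
          ip (f t) (h^-1 *: (g (h + t) - g t)) @[h --> 0^']
          --> ip df (g t) + ip (f t) dg.
  apply: cvgD; apply: cvg_ip => //; try exact: cvg_cst.
  - exact: is_derive_cvg_quotient.
  - exact: is_derive_cvg_quotient.
apply: cvg_trans fl; apply: near_eq_cvg; apply: nearW => h /=.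
rewrite ipZl ipZr -mulrDr; congr (_ * _).
by rewrite !(ipDl, ipDr, ipNl, ipNr); lra.
Qed.

(** The choice operator in [gradient] returns a representative of the
    differential only if there is one, which strong convexity itself supplies:
    whatever the chosen vector is, its linear form supports [Phi] at [u], so the
    directional derivative at [u] dominates it in every direction [v].  Applied
    to [v] and to [- v], domination of one linear form by another is
    equality. *)
Lemma strongly_convex_gradient mu (Phi : H -> R) u w :
  strongly_convex ip mu Phi -> differentiable Phi u ->
  'd Phi u w = ip (gradient ip Phi u) w.
Proof.
move=> scPhi dPhi.
suff ge_ip v : ip (gradient ip Phi u) v <= 'd Phi u v.
  apply/eqP; rewrite eq_le ge_ip andbT -lerN2 -ipNr.
  by rewrite (le_trans (ge_ip _))// linearN.
have quot : h^-1 *: (Phi (h *: v + u) - Phi u) @[h --> 0^'+] --> 'd Phi u v.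
  rewrite -deriveE//; apply: cvg_dnbhs_at_right.
  exact: (diff_derivable dPhi).
have bound : ip (gradient ip Phi u) v + mu / 2 * (h * `|v| ^+ 2) @[h --> 0^'+]
    --> ip (gradient ip Phi u) v.
  rewrite -[X in _ --> X](_ : ip (gradient ip Phi u) v +
    mu / 2 * (0 * `|v| ^+ 2) = _); last by rewrite mul0r mulr0 addr0.
  apply: cvgD; first exact: cvg_cst.
  apply: cvgM; first exact: cvg_cst.
  apply: cvgM; last exact: cvg_cst.
  by apply: cvg_within.
apply: (ler_cvg_to bound quot); near=> h.
have h0 : 0 < h by [].
have := scPhi u (h *: v + u); rewrite addrK ipZr normrZ gtr0_norm// => h1.
rewrite -[X in _ <= X]/(_ * _) [X in _ <= X]mulrC ler_pdivlMr//.
by lra.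
Unshelve. all: by end_near. Qed.

Lemma is_derive_along mu (Phi : H -> R) (x : R -> H) (t : R) (dx : H) :
  strongly_convex ip mu Phi -> (forall u, differentiable Phi u) ->
  is_derive t 1 x dx ->
  is_derive t 1 (Phi \o x) (ip (gradient ip Phi (x t)) dx).
Proof.
move=> scPhi dPhi [/derivable1_diffP x_diff x'].
have d_comp : differentiable (Phi \o x) t by exact: differentiable_comp.
split; first exact/derivable1_diffP.
rewrite deriveE// diff_comp//= -(strongly_convex_gradient _ scPhi)//.
by rewrite -x' deriveE.
Qed.

End inner_product.

(** * The damping coefficient *)

Lemma cvg_at_right0 {R : realType} {T : Type} (F : set_system T)
    {FF : Filter F} (f : T -> R) :
  f @ F --> 0 -> (\forall x \near F, 0 < f x) -> f @ F --> 0^'+.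
Proof.
move=> f0 f_gt0 A A0.
have {}A0 : \forall r \near (0 : R), 0 < r -> A r := A0.
have fA : \forall x \near F, 0 < f x -> A (f x) := f0 _ A0.
suff: \forall x \near F, A (f x) by [].
by apply: filterS2 f_gt0 fA => x fx; exact.
Qed.

Section profile.
Context {R : realType} (S : R -> R).
Hypothesis S_C1 : C1_within `[0, +oo[ S.

Let S' : R -> R := derive_within `[0, +oo[ S.

Lemma C1_is_derive (r : R) : 0 < r -> is_derive r 1 S (S' r).
Proof.
move=> r0; apply: derivable_within_is_derive; last first.
  by apply: S_C1.1; rewrite /= in_itv/= ltW.
apply: filterS (lt_nbhsr r0) => s /=; rewrite in_itv/= andbT; exact: ltW.
Qed.

Lemma C1_slope0 : S 0 = 0 -> r^-1 * S r @[r --> 0^'+] --> S' 0.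
Proof.
move=> S0; have D0 : `[0, +oo[%classic (0 : R) by rewrite /= in_itv/= lexx.
have q : (r - 0)^-1 *: (S r - S 0) @[r --> within `[0, +oo[ (0 : R)^'] --> S' 0.
  by have := S_C1.1 _ D0.
have le_filter : (0 : R)^'+ `=>` within `[0, +oo[ (0 : R)^'.
  move=> A; rewrite /within/= /dnbhs /at_right /within/= => At.
  have {}At : \forall r \near (0 : R), r != 0 -> r \in `[0, +oo[ -> A r := At.
  suff: \forall r \near (0 : R), 0 < r -> A r by [].
  apply: filterS At => r Ar r0; apply: Ar; first by rewrite gt_eqF.
  by rewrite in_itv/= ltW.
apply: cvg_trans (cvg_trans _ q); last exact: (cvg_app _ le_filter).
by apply: near_eq_cvg; apply: nearW => r; rewrite subr0 S0 subr0.
Qed.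

Lemma C1_deriv0 : S' r @[r --> 0^'+] --> S' 0.
Proof.
have D0 : `[0, +oo[%classic (0 : R) by rewrite /= in_itv/= lexx.
have /subspace_continuousP/(_ _ D0) := S_C1.2.
apply: cvg_trans; apply: cvg_app => A; rewrite /within/= => At.
have {}At : \forall r \near (0 : R), r \in `[0, +oo[ -> A r := At.
suff: \forall r \near (0 : R), 0 < r -> A r by [].
apply: filterS At => r Ar r0; apply: Ar.
by rewrite in_itv/= ltW.
Qed.

Lemma is_derive_theta (mu t : R) : 0 < mu -> 0 < t ->
  is_derive t 1 (theta S mu) (S' (Num.sqrt mu * t)).
Proof.
move=> mu0 t0; have q0 : 0 < Num.sqrt mu by rewrite sqrtr_gt0.
have dl : is_derive t (1 : R) ( *%R (Num.sqrt mu)) (Num.sqrt mu).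
  by apply: is_derive_eq; rewrite [_ *: _]mulr1.
have dS := C1_is_derive (mulr_gt0 q0 t0).
have := is_deriveZ (Num.sqrt mu)^-1 (is_derive1_comp dS dl).
by rewrite [X in is_derive _ _ _ X -> _]mulrCA mulVf ?mulr1// gt_eqF.
Qed.

Lemma dampingE (mu t : R) : 0 < mu -> 0 < t ->
  damping S mu t =
    (1 + S' (Num.sqrt mu * t)) / theta S mu t + mu * theta S mu t.
Proof.
move=> mu0 t0; rewrite /damping derive1E.
by have [_ ->] := is_derive_theta mu0 t0.
Qed.

(** With r = q t the damping is ((1 + S'(r)) / (S(r)/r)) / t + (r/t) S(r), and r
    tends to 0 from the right together with [mu]. *)
Lemma cvg_damping_mu0 (t : R) : S 0 = 0 -> 0 < t -> S' 0 != 0 ->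
  damping S mu t @[mu --> 0^'+] --> (1 + 1 / S' 0) / t.
Proof.
move=> S0 t0 k0.
have r_cvg : Num.sqrt mu * t @[mu --> 0^'+] --> (0 : R)^'+.
  have r0 : Num.sqrt mu * t @[mu --> 0^'+] --> Num.sqrt (0 : R) * t.
    apply: cvgM; last exact: cvg_cst.
    by apply: cvg_at_right_filter; exact: sqrt_continuous.
  rewrite sqrtr0 mul0r in r0; apply: cvg_at_right0 => //.
  by near=> mu; rewrite mulr_gt0// sqrtr_gt0.
have q_cvg := C1_slope0 S0.
have lim : (1 + S' r) / (r^-1 * S r) / t + r / t * (r * (r^-1 * S r))
    @[r --> 0^'+] --> (1 + S' 0) / S' 0 / t + 0 / t * (0 * S' 0).
  have id0 : r @[r --> (0 : R)^'+] --> (0 : R) by apply: cvg_within.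
  apply: cvgD; apply: cvgM => //; try exact: cvg_cst.
  - apply: cvgM; last exact: cvgV.
    by apply: cvgD; [exact: cvg_cst|exact: C1_deriv0].
  - by apply: cvgM => //; exact: cvg_cst.
  - by apply: cvgM.
have := cvg_comp _ _ r_cvg lim.
rewrite mul0r mul0r addr0 (_ : (1 + S' 0) / S' 0 = 1 + 1 / S' 0); last first.
  by field.
apply: cvg_trans; apply: near_eq_cvg; near=> mu.
have mu0 : 0 < mu by [].
rewrite dampingE//= /theta.
have q0 : 0 < Num.sqrt mu by rewrite sqrtr_gt0.
have := sqr_sqrtr (ltW mu0); move: (Num.sqrt mu) q0 => q q0 <-.
(* Both sides agree even where S vanishes, inverses of 0 being 0. *)
have [S00|Sn0] := eqVneq (S (q * t)) 0.
  by rewrite S00 !(mulr0, invr0, mul0r, addr0).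
by field; rewrite Sn0 !gt_eqF.
Unshelve. all: by end_near. Qed.

(** With r = q t the damping is q ((1 + S'(r)) / S(r) + S(r)). *)
Lemma cvg_damping_pinfty (mu : R) : 0 < mu ->
  S r @[r --> +oo] --> (1 : R) -> S' r @[r --> +oo] --> (0 : R) ->
  damping S mu t @[t --> +oo] --> 2 * Num.sqrt mu.
Proof.
move=> mu0 S1 S'0; have q0 : 0 < Num.sqrt mu by rewrite sqrtr_gt0.
have r_cvg : Num.sqrt mu * t @[t --> +oo] --> +oo.
  by apply: gt0_cvgMry => //; exact: cvg_id.
have lim : Num.sqrt mu * ((1 + S' r) / S r + S r) @[r --> +oo] -->
    Num.sqrt mu * ((1 + 0) / 1 + 1).
  apply: cvgM; first exact: cvg_cst.
  apply: cvgD => //; apply: cvgM; last exact: cvgV.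
  by apply: cvgD => //; exact: cvg_cst.
have := cvg_comp _ _ r_cvg lim.
rewrite addr0 divr1 mulrC -[1 + 1]/(2 : R).
apply: cvg_trans; apply: near_eq_cvg; near=> t.
have t0 : 0 < t by [].
rewrite dampingE//= /theta.
have := sqr_sqrtr (ltW mu0); move: (Num.sqrt mu) q0 => q q0 <-.
(* Both sides agree even where S vanishes, inverses of 0 being 0. *)
have [S00|Sn0] := eqVneq (S (q * t)) 0.
  by rewrite S00 !(mulr0, invr0, mul0r, addr0).
by field; rewrite Sn0 !gt_eqF.
Unshelve. all: by end_near. Qed.

End profile.

(** * The exponent of the weight *)

Section primitive.
Context {R : realType} (f : R -> R) (a : R).
Hypothesis cf : {within `[a, +oo[, continuous f}.

Let F (x : R) := \int[lebesgue_measure]_(s in `[a, x]) f s.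

Lemma continuous_itv_integrable (b : R) :
  (@lebesgue_measure R).-integrable `[a, b] (EFin \o f).
Proof.
apply: continuous_compact_integrable; first exact: segment_compact.
by apply: continuous_subspaceW cf => s /=; rewrite !in_itv/= => /andP[->].
Qed.

Lemma continuous_is_derive_primitive (t : R) : a < t -> is_derive t 1 F (f t).
Proof.
move=> a_t; have ft : {for t, continuous f}.
  apply: (@within_continuous_continuous _ _ _ a (t + 1)); first by lra.
    by apply: continuous_subspaceW cf => s /=; rewrite !in_itv/= => /andP[->].
  by rewrite in_itv/= a_t; lra.
have tt1 : t < t + 1 by lra.
have := continuous_FTC1_closed tt1 (continuous_itv_integrable (t + 1)) a_t ft.
by rewrite derive1E => -[dF F't]; split.
Qed.

Lemma continuous_cvg_primitive : F s @[s --> a] --> F a.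
Proof.
have aa1 : a < a + 1 by lra.
rewrite {2}/F set_itv1 Rintegral_set1.
have intf := continuous_itv_integrable (a + 1).
exact: (parameterized_integral_cvg_left aa1 intf).
Qed.

End primitive.

Section weight_bounds.
Context {R : realType} (S : R -> R).
Hypothesis S_C1 : C1_within `[0, +oo[ S.
Hypothesis S_range : forall r : R, 0 <= r -> 0 <= S r < 1.
Hypothesis S_incr : forall r s : R, 0 <= r -> r <= s -> S r <= S s.

Let P (r : R) := \int[lebesgue_measure]_(s in `[0, r]) (1 - S s).

Let S_cont : {within `[0, +oo[, continuous S}.
Proof. exact: derivable_within_subspace_continuous S_C1.1. Qed.

Let cS_cont : {within `[0, +oo[, continuous (fun r : R => 1 - S r)}.
Proof.
by move=> r; apply: continuousB; [exact: cst_continuous|exact: S_cont].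
Qed.

Lemma gap_integral_ge0 r : 0 <= P r.
Proof.
apply: Rintegral_ge0 => s /=; rewrite in_itv/= => /andP[s0 _].
by have /andP[_ /ltW] := S_range s0; rewrite subr_ge0.
Qed.

Lemma gap_integral_le_xi r :
  (\int[@lebesgue_measure R]_(r in `[0%R, +oo[) (1 - S r)%R%:E < +oo)%E ->
  P r <= xi S.
Proof.
move=> fin; rewrite /P /xi /Rintegral.
have ge0 (s : R) : 0 <= s -> (0 <= (1 - S s)%:E)%E.
  by move=> /S_range/andP[_ /ltW]; rewrite lee_fin subr_ge0.
have le : (\int[@lebesgue_measure R]_(s in `[0%R, r]) (1 - S s)%:E <=
    \int[@lebesgue_measure R]_(s in `[0%R, +oo[) (1 - S s)%:E)%E.
  apply: ge0_subset_integral => //.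
  - apply/measurable_EFinP; exact: subspace_continuous_measurable_fun.
  - by move=> s; rewrite /= in_itv/= andbT => /ge0.
  - by move=> s /=; rewrite !in_itv/= => /andP[->].
apply: fine_le => //.
- rewrite ge0_fin_numE; first exact: le_lt_trans le fin.
  by apply: integral_ge0 => s /=; rewrite in_itv/= => /andP[/ge0].
- rewrite ge0_fin_numE//; apply: integral_ge0 => s /=.
  by rewrite in_itv/= andbT => /ge0.
Qed.

Section fixed_mu.
Context (mu t0 : R).
Hypotheses (mu0 : 0 < mu) (t00 : 0 < t0).

Let q := Num.sqrt mu.
Let q0 : 0 < q. Proof. by rewrite sqrtr_gt0. Qed.
Let G (t : R) := \int[lebesgue_measure]_(s in `[t0, t]) (mu * theta S mu s).

Lemma mu_thetaE t : mu * theta S mu t = q * S (q * t).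
Proof.
rewrite /theta -/q -[mu](sqr_sqrtr (ltW mu0)) -/q; field.
by rewrite gt_eqF.
Qed.

Lemma exponent_continuous :
  {within `[t0, +oo[, continuous (fun t : R => mu * theta S mu t)}.
Proof.
apply: continuous_in_subspaceT => t; rewrite inE/= in_itv/= andbT => t0t.
apply: continuousM; first exact: cst_continuous.
have tp := lt_le_trans t00 t0t.
exact: (is_derive_continuous (is_derive_theta S_C1 mu0 tp)).
Qed.

Lemma is_derive_exponent t : t0 < t -> is_derive t 1 G (q * S (q * t)).
Proof.
move=> /(continuous_is_derive_primitive exponent_continuous).
by rewrite mu_thetaE.
Qed.

Lemma cvg_exponent : G s @[s --> t0] --> G t0.
Proof. exact: continuous_cvg_primitive exponent_continuous. Qed.

Lemma exponent_t0 : G t0 = 0.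
Proof. by rewrite /G set_itv1 Rintegral_set1. Qed.

(** After [b] the slope of [G] is at least [s * q], because [S] increases. *)
Lemma exponent_ge_affine (b s t : R) : t0 <= b -> b <= t -> s <= S (q * b) ->
  G b + s * q * (t - b) <= G t.
Proof.
move=> t0b bt sS.
have dl (u : R) : is_derive u (1 : R) (fun u : R => s * q * u) (s * q).
  by apply: is_derive_eq; rewrite [_ *: _]mulr1.
have : G b - s * q * b <= G t - s * q * t.
  apply: (@is_derive_ge0_ndecr _ (fun u => G u - s * q * u)
    (fun u => q * S (q * u) - s * q)) => //.
  - apply: cvg_within_filter; apply: cvgB.
      move: t0b; rewrite le_eqVlt => /predU1P[<-|]; first exact: cvg_exponent.
      by move=> /is_derive_exponent /is_derive_continuous.
    by apply: cvgM; [exact: cvg_cst|exact: cvg_id].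
  - move=> u bu; have dG := is_derive_exponent (le_lt_trans t0b bu).
    exact: (is_deriveB dG (dl u)).
  - move=> u bu; rewrite [s * q]mulrC -mulrBr mulr_ge0 ?(ltW q0)//.
    rewrite subr_ge0 (le_trans sS)// S_incr ?ler_pM2l// ?(ltW bu)//.
    by rewrite mulr_ge0 ?(ltW q0)// (le_trans (ltW t00)).
lra.
Qed.

(** The function G(t) - q t + P(q t), with P the primitive of 1 - S, has
    derivative 0; comparing derivatives in this way replaces a change of
    variables in the integral defining [G]. *)
Lemma exponent_ge_gap t : t0 <= t -> q * t - q * t0 - P (q * t) <= G t.
Proof.
move=> t0t.
have dl (u : R) : is_derive u (1 : R) (fun u : R => q * u) q.
  by apply: is_derive_eq; rewrite [_ *: _]mulr1.
have dP (u : R) : t0 <= u ->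
    is_derive u 1 (P \o (fun u : R => q * u)) ((1 - S (q * u)) * q).
  move=> t0u; apply: is_derive1_comp.
  apply: (continuous_is_derive_primitive cS_cont).
  by rewrite mulr_gt0// (lt_le_trans t00).
have : G t0 - q * t0 + P (q * t0) <= G t - q * t + P (q * t).
  apply: (@is_derive_ge0_ndecr _ (fun u => G u - q * u + P (q * u))
    (fun u => q * S (q * u) - q + (1 - S (q * u)) * q)) => //.
  - apply: cvg_within_filter; apply: cvgD; last first.
      exact: (is_derive_continuous (dP _ (lexx _))).
    apply: cvgB; first exact: cvg_exponent.
    by apply: cvgM; [exact: cvg_cst|exact: cvg_id].
  - move=> u t0u.
    have dB := is_deriveB (is_derive_exponent t0u) (dl u).
    exact: (is_deriveD dB (dP _ (ltW t0u))).
  - by move=> u _; rewrite (_ : _ + _ = 0)//; ring.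
by rewrite exponent_t0; have := gap_integral_ge0 (q * t0); lra.
Qed.

Lemma weightE t : weight S mu t0 t = S (q * t) ^+ 2 / mu * expR (G t).
Proof.
rewrite /weight -/(G t); congr (_ * _).
by rewrite /theta exprMn exprVn sqr_sqrtr ?(ltW mu0)// mulrC.
Qed.

End fixed_mu.
End weight_bounds.

(** * Growth of the weight *)

(** This is exp (y - 1) >= y, squared, for y = s r / 2. *)
Lemma expR_affine_ge_sqr {R : realType} (s r a : R) : 0 <= s * r ->
  s ^+ 4 / 4 * expR (2 - s * a) * r ^+ 2 <= s ^+ 2 * expR (s * (r - a)).
Proof.
move=> sr0; set y := s * r / 2.
have y0 : 0 <= y by rewrite divr_ge0.
have -> : s * (r - a) = (2 - s * a) + 2 * (y - 1) by rewrite /y; lra.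
set z := 2 - s * a; rewrite [expR (z + _)]expRD expRM_natl.
have -> : s ^+ 4 / 4 * expR z * r ^+ 2 = s ^+ 2 * (expR z * y ^+ 2).
  by rewrite /y; field.
rewrite ler_wpM2l ?sqr_ge0// ler_wpM2l ?expR_ge0//.
rewrite ler_sqr ?nnegrE ?expR_ge0//.
by have := expR_ge1Dx (y - 1); lra.
Qed.

Section rates.
Context {R : realType} (S : R -> R).
Hypothesis S_range : forall r : R, 0 <= r -> 0 <= S r < 1.
Hypothesis S_C1 : C1_within `[0, +oo[ S.
Hypothesis S_incr : forall r s : R, 0 <= r -> r <= s -> S r <= S s.
Hypothesis S_0 : S 0 = 0.
Hypothesis S'_0 : 0 < derive_within `[0, +oo[ S 0.

(** The slope at 0 is positive, so [S] is positive somewhere between 0 and [r],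
    and then at [r] because [S] increases. *)
Lemma profile_gt0 r : 0 < r -> 0 < S r.
Proof.
move=> r0; have := C1_slope0 S_C1 S_0 => /cvgr_gt /(_ _ S'_0) slope.
near (0 : R)^'+ => s.
have s0 : 0 < s by [].
have sr : s < r by near: s; exact: nbhs_right_lt.
apply: lt_le_trans (S_incr (ltW s0) (ltW sr)).
have : 0 < s^-1 * S s by near: s.
by rewrite pmulr_rgt0// invr_gt0.
Unshelve. all: by end_near. Qed.

Hypothesis S_concave :
  convex_function (E := R^o) `[0, +oo[ (fun r : R => - S r).

Lemma concave_ge_chord r : 0 <= r <= 1 -> r * S 1 <= S r.
Proof.
move=> /andP[r0 r1].
have := S_concave (Itv01 r0 r1) (x := 1) (y := 0).
rewrite !inE/= !in_itv/= ler01 lexx => /(_ isT isT).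
rewrite convRE/= /conv/= S_0.
rewrite -![_ *: _]/(_ * _) /=.
by rewrite mulr1 mulr0 addr0 oppr0 mulr0 addr0 mulrN lerN2.
Qed.

Section fixed_mu.
Context (mu t0 : R).
Hypotheses (mu0 : 0 < mu) (t00 : 0 < t0).
Let q := Num.sqrt mu.
Let q0 : 0 < q. Proof. by rewrite sqrtr_gt0. Qed.
Let qq : q ^+ 2 = mu. Proof. by rewrite sqr_sqrtr ?ltW. Qed.

Lemma rate_constant_gt0 : 0 < rate_constant S mu t0.
Proof.
have S1 : 0 < S 1 by exact: profile_gt0.
have Sr0 : 0 < S (q * t0) by apply: profile_gt0; exact: mulr_gt0.
rewrite /rate_constant -/q; case: ifP => _.
  by rewrite lt_min exprn_gt0//= mulr_gt0 ?expR_gt0// divr_gt0// exprn_gt0.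
by rewrite mulr_gt0 ?expR_gt0// divr_gt0// exprn_gt0.
Qed.

Lemma weight_gt0 t : t0 <= t -> 0 < weight S mu t0 t.
Proof.
move=> t0t; rewrite weightE// mulr_gt0 ?expR_gt0// divr_gt0// exprn_gt0//.
by apply: profile_gt0; rewrite mulr_gt0// (lt_le_trans t00).
Qed.

(** [late b] bounds the weight from the value of [S] at [q * b], for any time
    [b] between [t0] and [t].  The two branches of the constant correspond to
    [b = t0] and to the time [b = q^-1] at which [q * b = 1]; before that time
    concavity takes over. *)
Lemma weight_ge_sqr t : t0 <= t ->
  rate_constant S mu t0 * t ^+ 2 <= weight S mu t0 t.
Proof.
move=> t0t; have tp : 0 < t by exact: lt_le_trans t0t.
have qt0 : 0 < q * t by exact: mulr_gt0.
rewrite weightE// -/q; set G := (\int[_]_(_ in _) _).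
have Gge := exponent_ge_affine S_C1 S_incr mu0 t00.
have G0 : 0 <= G.
  have S00 : 0 <= S (q * t0) by apply/ltW/profile_gt0; exact: mulr_gt0.
  have := Gge t0 0 t (lexx _) t0t S00.
  by rewrite exponent_t0// !mul0r add0r.
have late b : t0 <= b -> b <= t ->
    S (q * b) ^+ 4 / 4 * expR (2 - S (q * b) * (q * b)) * t ^+ 2 <=
    S (q * t) ^+ 2 / mu * expR G.
  move=> t0b bt; set s := S (q * b).
  have s0 : 0 <= s.
    by apply/ltW/profile_gt0; rewrite mulr_gt0// (lt_le_trans t00).
  have sS : s <= S (q * t).
    by apply: S_incr; rewrite ?ler_pM2l// mulr_ge0 ?ltW// (lt_le_trans t00).
  have GE : s * (q * t - q * b) <= G.
    have GbE := Gge b s t t0b bt (lexx _).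
    have S00 : 0 <= S (q * t0) by apply/ltW/profile_gt0; exact: mulr_gt0.
    have := Gge t0 0 b (lexx _) t0b S00.
    rewrite exponent_t0// !mul0r add0r => Gb0.
    rewrite -mulrBr mulrA; apply: le_trans GbE.
    by rewrite lerDr.
  have h := @expR_affine_ge_sqr _ s (q * t) (q * b) (mulr_ge0 s0 (ltW qt0)).
  rewrite [leRHS]mulrAC ler_pdivlMr// (_ : _ * mu =
    s ^+ 4 / 4 * expR (2 - s * (q * b)) * (q * t) ^+ 2); last first.
    by rewrite exprMn qq; ring.
  apply: (le_trans h); apply: ler_pM; rewrite ?expR_ge0 ?exprn_ge0 ?ler_expR//.
  by rewrite ler_sqr ?nnegrE// (le_trans s0).
rewrite /rate_constant -/q; case: ifPn => [r01|_]; last exact: late.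
have [qt1|qt1] := leP (q * t) 1.
  apply: (@le_trans _ _ (S 1 ^+ 2 * t ^+ 2)).
    by rewrite ler_wpM2r ?sqr_ge0// ge_min lexx.
  apply: (@le_trans _ _ (S (q * t) ^+ 2 / mu)).
    rewrite ler_pdivlMr// (_ : _ * mu = (q * t * S 1) ^+ 2); last first.
      by rewrite !exprMn qq; ring.
    have S1 : 0 <= S 1 by exact/ltW/profile_gt0.
    rewrite ler_sqr ?nnegrE; last 2 first.
    - by rewrite mulr_ge0// ltW.
    - exact/ltW/profile_gt0.
    by apply: concave_ge_chord; rewrite (ltW qt0).
  rewrite ler_peMr //; last by rewrite -expR0 ler_expR.
  by rewrite divr_ge0 ?sqr_ge0 ?ltW.
have qV1 : q * q^-1 = 1 by rewrite divff// gt_eqF.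
apply: (@le_trans _ _ (S 1 ^+ 4 / 4 * expR (2 - S 1) * t ^+ 2)).
  by rewrite ler_wpM2r ?sqr_ge0// ge_min lexx orbT.
have := late q^-1; rewrite qV1 mulr1; apply.
- by rewrite -(ler_pM2l q0) qV1.
- by rewrite -(ler_pM2l q0) qV1 ltW.
Qed.

Hypothesis xi_fin :
  (\int[@lebesgue_measure R]_(r in `[0%R, +oo[) (1 - S r)%R%:E < +oo)%E.

(** The exponent loses at most [xi S] against [q * t - q * t0]. *)
Lemma weight_ge_expR t : t0 <= t ->
  (mu * expR (q * t0 + xi S) / S (q * t0) ^+ 2 * expR (- (q * t)))^-1
  <= weight S mu t0 t.
Proof.
move=> t0t.
have Sr0 : 0 < S (q * t0) by apply: profile_gt0; exact: mulr_gt0.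
have SS : S (q * t0) <= S (q * t).
  by apply: S_incr; rewrite ?ler_pM2l// mulr_ge0 ?ltW.
rewrite weightE// -/q; set G := (\int[_]_(_ in _) _).
have GE : q * t - (q * t0 + xi S) <= G.
  have := exponent_ge_gap S_C1 S_range mu0 t00 t0t.
  have := gap_integral_le_xi S_C1 S_range (q * t) xi_fin.
  by rewrite -/q -/G; lra.
rewrite [X in X <= _](_ : _ =
    S (q * t0) ^+ 2 / mu * expR (q * t - (q * t0 + xi S))).
  apply: ler_pM; rewrite ?expR_ge0 ?ler_expR//.
    by rewrite divr_ge0 ?sqr_ge0 ?ltW.
  rewrite ler_pM2r ?invr_gt0// ler_sqr ?nnegrE//; first exact: ltW.
  by rewrite (le_trans (ltW Sr0)).
rewrite expRB expRN; field.
by rewrite !gt_eqF ?expR_gt0.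
Qed.

End fixed_mu.
End rates.

(** * Decay of the energy *)

(** The derivative of the energy, divided by the exponential factor W, once the
    equation of motion has eliminated the second derivative.  Here [a], [b] and
    [c] are |d|^2, <d, x'> and |x'|^2, [gd] and [gy] are the inner products of
    the gradient with d and x', and [phi] is the objective gap. *)
Lemma dissipation_le0 {R : realFieldType} (mu th th' del phi a b c gd gy : R) :
  0 <= mu -> 0 <= th -> th * del = 1 + th' + mu * th ^+ 2 ->
  2 * th' + mu * th ^+ 2 <= 1 -> 0 <= phi -> 0 <= c ->
  phi + mu / 2 * a <= gd ->
  mu * th * (th ^+ 2 * phi + (a + 2 * th * b + th ^+ 2 * c) / 2) +
  (2 * th * th' * phi + th ^+ 2 * gy +
   (2 * b + 2 * th' * b + 2 * th * (c - del * b - gd) + 2 * th * th' * c +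
    th ^+ 2 * (- 2 * del * c - 2 * gy)) / 2) <= 0.
Proof.
move=> mu0 th0 delE th1 phi0 c0 gdE.
(* The last term carries all occurrences of the damping, with the factor that
   the equation for [del] annihilates. *)
rewrite [X in X <= _](_ : _ = - (th * (1 - (2 * th' + mu * th ^+ 2)) * phi) -
  th * (gd - (phi + mu / 2 * a)) - mu * th ^+ 3 * c / 2 -
  (th * del - (1 + th' + mu * th ^+ 2)) * (b + th * c)); last by field.
rewrite delE subrr mul0r subr0.
have h1 : 0 <= th * (1 - (2 * th' + mu * th ^+ 2)) * phi.
  by rewrite mulr_ge0// mulr_ge0// subr_ge0.
have h2 : 0 <= th * (gd - (phi + mu / 2 * a)) by rewrite mulr_ge0// subr_ge0.
have h3 : 0 <= mu * th ^+ 3 * c by rewrite mulr_ge0// mulr_ge0// exprn_ge0.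
lra.
Qed.

Section energy_decay.
Context {R : realType} (S : R -> R).
Hypothesis S_C1 : C1_within `[0, +oo[ S.
Hypothesis S_incr : forall r s : R, 0 <= r -> r <= s -> S r <= S s.
Hypothesis S_0 : S 0 = 0.
Hypothesis S'_0 : 0 < derive_within `[0, +oo[ S 0.
Hypothesis S_ineq : forall r : R, 0 <= r ->
  2 * derive_within `[0, +oo[ S r + S r ^+ 2 <= 1.
Context (mu t0 : R).
Hypotheses (mu0 : 0 < mu) (t00 : 0 < t0).
Context (H : completeNormedModType R) (ip : {dot H for idfun})
  (Phi : H -> R) (xs : H).
Hypotheses (ipE : induces_norm ip) (Phi_diff : forall u, differentiable Phi u)
  (Phi_sc : strongly_convex ip mu Phi) (Phi_min : argmin Phi xs).
Context (x : R -> H).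
Hypothesis x_sol : solution ip S mu t0 Phi x.

Let q := Num.sqrt mu.
Let q0 : 0 < q. Proof. by rewrite sqrtr_gt0. Qed.
Let qq : q ^+ 2 = mu. Proof. by rewrite sqr_sqrtr ?ltW. Qed.
Let y : R -> H := derive_within `[t0, +oo[ x.
Let z : R -> H := derive_within `[t0, +oo[ y.
Let th : R -> R := theta S mu.
Let th' (t : R) : R := derive_within `[0, +oo[ S (q * t).
Let W (t : R) : R :=
  expR (\int[lebesgue_measure]_(s in `[t0, t]) (mu * theta S mu s)).
Let phi (t : R) : R := Phi (x t) - Phi xs.
Let g (t : R) : H := gradient ip Phi (x t).
(** The energy with its square expanded: every factor is then a real function,
    or an inner product covered by [is_derive_ip]. *)
Let E (t : R) : R := W t * (th t * th t * phi t +
  2^-1 * (ip (x t - xs) (x t - xs) + 2 * (th t * ip (x t - xs) (y t)) +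
   th t * th t * ip (y t) (y t))).

Lemma energyE t : t0 <= t -> energy S mu t0 Phi xs x t = E t.
Proof.
move=> t0t; have tp := lt_le_trans t00 t0t.
have th0 : 0 < th t.
  rewrite /th /theta mulr_gt0 ?invr_gt0//.
  by apply: (profile_gt0 S_C1 S_incr S_0 S'_0); exact: mulr_gt0.
rewrite /energy -ipE !(ipDl, ipDr, ipNl, ipNr, ipZl, ipZr) /weight.
rewrite -/(W t) -/(th t) -/y.
rewrite /E !(ipDl, ipDr, ipNl, ipNr) !(ipC _ (y t)) /phi; field.
by rewrite gt_eqF.
Qed.

Let nbhs_itv t : t0 < t -> nbhs t `[t0, +oo[%classic.
Proof.
move=> t0t; apply: filterS (lt_nbhsr t0t) => s /=.
by rewrite in_itv/= andbT; exact: ltW.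
Qed.

Let in_itv_le t : t0 <= t -> `[t0, +oo[%classic t.
Proof. by rewrite /= in_itv/= andbT. Qed.

Let dx t : t0 < t -> is_derive t 1 x (y t).
Proof.
move=> t0t; apply: derivable_within_is_derive; first exact: nbhs_itv.
by apply: x_sol.1.1.1; apply: in_itv_le; exact: ltW.
Qed.

Let dy t : t0 < t -> is_derive t 1 y (z t).
Proof.
move=> t0t; apply: derivable_within_is_derive; first exact: nbhs_itv.
by apply: x_sol.1.2.1; apply: in_itv_le; exact: ltW.
Qed.

Let zE t : t0 <= t -> z t = - (damping S mu t *: y t + g t).
Proof.
move=> /x_sol.2; rewrite -/y -/z -/(g t) -addrA => /eqP.
by rewrite addr_eq0 => /eqP.
Qed.

Lemma energy_cvg_t0 : E s @[s --> within `[t0, +oo[ (nbhs t0)] --> E t0.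
Proof.
have D0 : `[t0, +oo[%classic t0 by exact: in_itv_le.
have x0 := derivable_within_cvg (x_sol.1.1.1 _ D0).
have y0 := derivable_within_cvg (x_sol.1.2.1 _ D0).
have d0 : x s - xs @[s --> within `[t0, +oo[ (nbhs t0)] --> x t0 - xs.
  by apply: cvgB => //; exact: cvg_cst.
have phi0 : phi s @[s --> within `[t0, +oo[ (nbhs t0)] --> phi t0.
  apply: cvgB; last exact: cvg_cst.
  exact: (cvg_comp _ _ x0 (differentiable_continuous (Phi_diff (x t0)))).
have th0 : th s @[s --> within `[t0, +oo[ (nbhs t0)] --> th t0.
  apply: cvg_within_filter.
  exact: (is_derive_continuous (is_derive_theta S_C1 mu0 t00)).
have W0 : W s @[s --> within `[t0, +oo[ (nbhs t0)] --> W t0.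
  apply: cvg_within_filter.
  exact: (cvg_comp _ _ (cvg_exponent S_C1 mu0 t00) (@continuous_expR _ _)).
apply: cvgM => //; apply: cvgD; first by do 2?apply: cvgM.
apply: cvgM; first exact: cvg_cst.
apply: cvgD; last by apply: cvgM; [exact: cvgM|exact: cvg_ip].
apply: cvgD; first exact: cvg_ip.
apply: cvgM; first exact: cvg_cst.
by apply: cvgM => //; exact: cvg_ip.
Qed.

Let dE (t : R) : R := W t * (mu * th t * (th t ^+ 2 * phi t +
    (ip (x t - xs) (x t - xs) + 2 * th t * ip (x t - xs) (y t) +
     th t ^+ 2 * ip (y t) (y t)) / 2) +
  (2 * th t * th' t * phi t + th t ^+ 2 * ip (g t) (y t) +
   (2 * ip (x t - xs) (y t) + 2 * th' t * ip (x t - xs) (y t) +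
    2 * th t * (ip (y t) (y t) - damping S mu t * ip (x t - xs) (y t) -
                ip (g t) (x t - xs)) +
    2 * th t * th' t * ip (y t) (y t) +
    th t ^+ 2 * (- 2 * damping S mu t * ip (y t) (y t) - 2 * ip (g t) (y t)))
   / 2)).

Lemma is_derive_energy t : t0 < t -> is_derive t 1 E (dE t).
Proof.
move=> t0t; have tp := lt_trans t00 t0t.
have dth : is_derive t 1 th (th' t) by exact: is_derive_theta.
have dW : is_derive t 1 W (W t * (mu * th t)).
  rewrite /th mu_thetaE//.
  apply: (is_derive1_comp (g := fun t =>
    \int[lebesgue_measure]_(s in `[t0, t]) (mu * theta S mu s))).
  exact: is_derive_exponent.
have dphi : is_derive t 1 phi (ip (g t) (y t)).
  have dPhi := is_derive_along Phi_sc Phi_diff (dx t0t).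
  have := is_deriveB dPhi (is_derive_cst (Phi xs) t (1 : R)).
  by rewrite subr0.
have dd : is_derive t 1 (fun s => x s - xs) (y t).
  by have := is_deriveB (dx t0t) (is_derive_cst xs t (1 : R)); rewrite subr0.
have da := is_derive_ip ipE dd dd.
have db := is_derive_ip ipE dd (dy t0t).
have dc := is_derive_ip ipE (dy t0t) (dy t0t).
have dth2 := is_deriveM dth dth.
have := is_deriveM dW (is_deriveD (is_deriveM dth2 dphi)
  (is_deriveZ 2^-1 (is_deriveD (is_deriveD da
     (is_deriveZ 2 (is_deriveM dth db))) (is_deriveM dth2 dc)))).
rewrite [X in is_derive _ _ _ X -> _](_ : _ = dE t) //.
rewrite zE ?(ltW t0t)// !fctE /= /dE.
move: (x t - xs) (y t) (g t) => d v w.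
rewrite !(ipNl, ipNr, ipDl, ipDr, ipZl, ipZr).
rewrite (ipC ip v d) (ipC ip v w) (ipC ip d w).
have scaleE (k r : R) : k *: (r : R^o) = k * r by [].
by rewrite !scaleE; field.

Qed.

Lemma energy_derive_le0 t : t0 < t -> dE t <= 0.
Proof.
move=> t0t; have tp := lt_trans t00 t0t; have qt0 := mulr_gt0 q0 tp.
have th0 : 0 < th t.
  rewrite /th /theta mulr_gt0 ?invr_gt0//.
  exact: (profile_gt0 S_C1 S_incr S_0 S'_0).
rewrite /dE pmulr_rle0 ?expR_gt0//; apply: dissipation_le0.
- exact: ltW.
- exact: ltW.
- by rewrite dampingE// -/q -/(th t) -/(th' t); field; rewrite gt_eqF.
- have := S_ineq (ltW qt0); rewrite /th' /th /theta exprMn exprVn -/q qq.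
  by rewrite mulrA divff ?mul1r// gt_eqF.
- by rewrite subr_ge0; exact: Phi_min.
- by rewrite ipE exprn_ge0.
- have := Phi_sc (x t) xs; rewrite -/(g t) -normrN opprB -ipE.
  rewrite -(opprB (x t)) ipNr /phi; lra.
Qed.

Lemma energy_nincr t : t0 <= t ->
  energy S mu t0 Phi xs x t <= energy S mu t0 Phi xs x t0.
Proof.
move=> t0t; rewrite !energyE// -lerN2.
apply: (@is_derive_ge0_ndecr _ (fun s => - E s) (fun s => - dE s)) => //.
- by apply: cvgN; exact: energy_cvg_t0.
- by move=> s /is_derive_energy; exact: is_deriveN.
- by move=> s /energy_derive_le0; rewrite oppr_ge0.
Qed.

(** The kinetic part of the energy is nonnegative and can be dropped. *)
Lemma objective_gap_le t : t0 <= t ->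
  phi t <= energy S mu t0 Phi xs x t0 / weight S mu t0 t.
Proof.
move=> t0t; have w0 := weight_gt0 S_C1 S_incr S_0 S'_0 mu0 t00 t0t.
rewrite ler_pdivlMr// mulrC; apply: le_trans (energy_nincr t0t).
rewrite /energy lerDl mulr_ge0 ?sqr_ge0// divr_ge0 ?(ltW w0)//.
by rewrite mulr_ge0// sqr_ge0.
Qed.

Lemma energy_ge0 : 0 <= energy S mu t0 Phi xs x t0.
Proof.
have w0 := weight_gt0 S_C1 S_incr S_0 S'_0 mu0 t00 (lexx t0).
rewrite /energy addr_ge0// mulr_ge0 ?sqr_ge0 ?(ltW w0)//.
  by rewrite subr_ge0; exact: Phi_min.
by rewrite divr_ge0 ?(ltW w0)// mulr_ge0// sqr_ge0.
Qed.

End energy_decay.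

(** * The damping limits and the convergence rates *)

Unset Implicit Arguments.
Set Strict Implicit.

Theorem theorem2p7 (R : realType) (S : R -> R) (kappa : R)
  (S_range : forall r : R, 0 <= r -> 0 <= S r < 1)
  (S_C1 : C1_within `[0, +oo[ S)
  (S_incr : forall r s : R, 0 <= r -> r <= s -> S r <= S s)
  (S_concave : convex_function (E := R^o) `[0, +oo[ (fun r : R => - S r))
  (S_0 : S 0 = 0)
  (S_ineq : forall r : R, 0 <= r ->
     0 < 2 * derive_within `[0, +oo[ S r + S r ^+ 2 <= 1)
  (S'_0 : derive_within `[0, +oo[ S 0 = kappa)
  (kappa_range : 0 < kappa <= 1 / 2)
  (S_lim : S r @[r --> +oo] --> (1 : R))
  (S'_lim : derive_within `[0, +oo[ S r @[r --> +oo] --> (0 : R))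
  (xi_fin :
     (\int[@lebesgue_measure R]_(r in `[0%R, +oo[) (1 - S r)%R%:E < +oo)%E) :
  let gamma := 1 + 1 / kappa in
  3 <= gamma /\
  (forall t : R, 0 < t -> damping S mu t @[mu --> 0^'+] --> gamma / t) /\
  (forall mu : R, 0 < mu -> damping S mu t @[t --> +oo] --> 2 * Num.sqrt mu) /\
  (forall mu t0 : R, 0 < mu -> 0 < t0 ->
   forall (H : completeNormedModType R) (ip : {dot H for idfun})
     (Phi : H -> R) (xs : H),
     induces_norm ip ->
     C1_frechet Phi ->
     strongly_convex ip mu Phi ->
     argmin Phi xs ->
   forall x : R -> H, solution ip S mu t0 Phi x ->
     (forall t : R, t0 <= t ->
        Phi (x t) - Phi xs <=
        energy S mu t0 Phi xs x t0 *
        Num.min (1 / (rate_constant S mu t0 * t ^+ 2))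
                (mu * expR (Num.sqrt mu * t0 + xi S) /
                   S (Num.sqrt mu * t0) ^+ 2 * expR (- (Num.sqrt mu * t)))) /\
     ((fun t : R => Phi (x t) - Phi xs) =O_+oo
      (fun t : R => Num.min (1 / t ^+ 2) (expR (- (Num.sqrt mu * t)))))).
Proof.
move=> gamma; move: (kappa_range) => /andP[kappa_gt0 kappa_le].
have S'_gt0 : 0 < derive_within `[0, +oo[ S 0 by rewrite S'_0.
split.
  rewrite /gamma; have : 2 <= 1 / kappa by rewrite ler_pdivlMr//; lra.
  lra.
split.
  move=> t t0; rewrite /gamma -S'_0.
  by apply: cvg_damping_mu0 => //; rewrite gt_eqF.
split; first by move=> mu mu0; exact: cvg_damping_pinfty.
move=> mu t0 mu0 t00 H ip Phi xs ipE [Phi_diff _] Phi_sc Phi_min x x_sol.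
set E0 := energy S mu t0 Phi xs x t0.
have S_le1 r : 0 <= r -> 2 * derive_within `[0, +oo[ S r + S r ^+ 2 <= 1.
  by move=> /S_ineq/andP[].
have E0_ge0 : 0 <= E0.
  exact: (energy_ge0 S_C1 S_incr S_0 S'_gt0 mu0 t00 Phi_min).
have C0 := rate_constant_gt0 S_C1 S_incr S_0 S'_gt0 mu0 t00.
set C := rate_constant S mu t0 in C0 *.
set K := mu * expR (Num.sqrt mu * t0 + xi S) / S (Num.sqrt mu * t0) ^+ 2.
have K0 : 0 < K.
  apply: divr_gt0; first by rewrite mulr_gt0 ?expR_gt0.
  apply/exprn_gt0/(profile_gt0 S_C1 S_incr S_0 S'_gt0).
  by rewrite mulr_gt0 ?sqrtr_gt0.
have bound (t : R) : t0 <= t -> Phi (x t) - Phi xs <=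
    E0 * Num.min (1 / (C * t ^+ 2)) (K * expR (- (Num.sqrt mu * t))).
  move=> t0t; have tp := lt_le_trans t00 t0t.
  apply: le_trans (objective_gap_le S_C1 S_incr S_0 S'_gt0 S_le1 mu0 t00
    ipE Phi_diff Phi_sc Phi_min x_sol t0t) _.
  have W0 := weight_gt0 S_C1 S_incr S_0 S'_gt0 mu0 t00 t0t.
  have Ct0 : 0 < C * t ^+ 2 by apply: mulr_gt0 => //; exact: exprn_gt0.
  have Ke0 : 0 < K * expR (- (Num.sqrt mu * t)).
    by apply: mulr_gt0 => //; exact: expR_gt0.
  rewrite ler_wpM2l// le_min; apply/andP; split.
    rewrite div1r lef_pV2//.
    exact: (weight_ge_sqr S_C1 S_incr S_0 S'_gt0 S_concave).
  rewrite -[K * _]invrK lef_pV2 ?posrE ?invr_gt0//.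
  exact: (weight_ge_expR S_range S_C1 S_incr S_0 S'_gt0).
split=> //; clearbody E0 C K; apply/eqO_exP; exists (E0 * Num.max C^-1 K + 1).
  by rewrite ltr_wpDl// mulr_ge0// le_max (ltW K0) orbT.
near=> t.
have t0t : t0 <= t by [].
have tp := lt_le_trans t00 t0t.
have m0 : 0 <= Num.min (1 / t ^+ 2) (expR (- (Num.sqrt mu * t))).
  by rewrite le_min expR_ge0 divr_ge0 ?sqr_ge0.
rewrite !ger0_norm ?subr_ge0//.
apply: le_trans (bound t t0t) _; rewrite mulrDl.
apply: ler_wpDr; first exact: mulr_ge0.
rewrite -mulrA ler_wpM2l//.
have M0 : 0 <= Num.max C^-1 K by rewrite le_max (ltW K0) orbT.
rewrite minr_pMr// le_min !ge_min; apply/andP; split; apply/orP; [left|right].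
  by rewrite !div1r invfM ler_wpM2r ?invr_ge0 ?sqr_ge0// le_max lexx.
by rewrite ler_wpM2r ?expR_ge0// le_max lexx orbT.
Unshelve. all: by end_near. Qed.
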